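(* Let $u^*\in K$ be the solution of the variational inequality $\langle\mathcal{L}u^*,v-u^*\rangle\ge F(v-u^* )$ for all $v\in K$, and let $\lambda^*\in Q'$ be the dual variable defined by $\langle B'\lambda^*,v\rangle=\langle\mathcal{L}u^*,v\rangle-F(v)$ for all $v\in V$. Let $V_h\subset V$ and $W_h\subset L^\infty(\Omega_d;\mathbb{R}^m)$ be finite-dimensional subspaces satisfying the discrete inf-sup condition $$\inf_{w\in W_h}\sup_{v\in V_h}\frac{b(v,w)}{\|v\|_V\,\|w\|_{Q'}}=\mu_h>\mu_0>0 ,$$ and let $\Pi_h:V\to V_h$ be an associated Fortin operator, i.e. a bounded linear operator with $b(v-\Pi_hv,w_h)=0$ for all $v\in V$, $w_h\in W_h$. Let $\psi_h^0\in W_h$, let $\{\alpha_k\}_{k\ge1}$ be positive real numbers, and for $k\ge1$ let $(u_h^k,\psi_h^k)\in V_h\times W_h$ be the solution of $$\alpha_k\,\mathcal{A}(u_h^k,v_h)+b(v_h,\psi_h^k-\psi_h^{k-1})=\alpha_k F(v_h)\quad\forall v_h\in V_h,\qquad b(u_h^k,w_h)-(\nabla\mathcal{R}^*(\psi_h^k),w_h)_{\Omega_d}=0\quad\forall w_h\in W_h .$$ Let $\overline u_h^\ell=\big(\sum_{k=1}^\ell\alpha_k\big)^{-1}\sum_{k=1}^\ell\alpha_ku_h^k$, $o^*=Bu^*$, and $o_h^0=\nabla\mathcal{R}^*(\psi_h^0)$. Then for any $\ell\ge1$, $$\frac{C_{\mathrm{coerc}}}{4}\|\overline u_h^\ell-u^*\|_V^2\le\frac{(\mathcal{D}(o^*,o_h^0),1)_{\Omega_d}}{\sum_{k=1}^\ell\alpha_k}+\frac{(C_{\mathrm{bnd}}+c_1)^2+C_{\mathrm{coerc}}^2}{2C_{\mathrm{coerc}}}\|\Pi_hu^*-u^*\|_V^2+|\langle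 B'\lambda^*,\Pi_hu^*-u^*\rangle|+\inf_{v\in K}|\langle B'\lambda^*,v-\overline u_h^\ell\rangle| .$$
   Context: **Variational setting.** $\Omega\subset\mathbb{R}^n$ ($n=1,2,3$) is a bounded Lipschitz domain; $\Omega_d\subset\overline\Omega$ is a Hausdorff-measurable set of dimension $d\le n$, with measure $\mathrm{d}\mathcal{H}_d$; $(\cdot,\cdot)_{\Omega_d}$ is the $L^2(\Omega_d;\mathbb{R}^m)$ inner product. $V$ is a real Hilbert space, $\mathcal{L}:V\to V'$ is linear, $F\in V'$, and $\mathcal{A}(u,v)=\langle\mathcal{L}u,v\rangle$ (not necessarily symmetric). Put $\mathcal{A}_0(u,v)=\tfrac12(\mathcal{A}(u,v)+\mathcal{A}(v,u))$ and $\mathcal{A}_n(u,v)=\tfrac12(\mathcal{A}(u,v)-\mathcal{A}(v,u))$. It is assumed that for all $u,v\in V$: $\mathcal{A}_n(u,v)\le c_1\|u\|_V\|v\|_V$, $\mathcal{A}_0(u,v)\le C_{\mathrm{bnd}}\|u\|_V\|v\|_V$, and $\mathcal{A}(u,u)\ge C_{\mathrm{coerc}}\|u\|_V^2$, with $c_1\ge0$, $C_{\mathrm{bnd}},C_{\mathrm{coerc}}>0$. $B:V\to Q$ is a bounded linear map with image $Q=\operatorname{im}B$, where $Q$ is a Banach space continuously and densely embedded in $L^2(\Omega_d;\mathbb{R}^m)$. $B':Q'\to V'$ is the transpose, $\langle B'\lambda,v\rangle=\langle\lambda,Bv\rangle$. Set $b(v,w)=(Bv,w)_{\Omega_d}$.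 A function $w\in L^2(\Omega_d;\mathbb{R}^m)$ is regarded as an element of $Q'$ via $q\mapsto(w,q)_{\Omega_d}$, and $\|w\|_{Q'}$ is the corresponding dual norm. For a.e. $x\in\Omega_d$, $C(x)\subset\mathbb{R}^m$ is a closed convex set with nonempty interior; the feasible set is $K=\{v\in V: Bv(x)\in C(x)\text{ for a.e. }x\in\Omega_d\}$, a (nonempty) closed convex set, and $\mathcal{O}=\{o\in L^2(\Omega_d;\mathbb{R}^m): o(x)\in C(x)\text{ a.e.}\}$. Under these assumptions $u^*$ and $\lambda^*$ exist and are unique. **Legendre function.** A (closed convex) function $L:\mathbb{R}^m\to\mathbb{R}\cup\{+\infty\}$ is a Legendre function if it is proper with $\operatorname{int}(\operatorname{dom}L)\neq\emptyset$, strictly convex and differentiable on $\operatorname{int}(\operatorname{dom}L)$, and has a singular gradient on the boundary of $\operatorname{dom}L$ ($|\nabla L(y_j)|\to\infty$ when $y_j\in\operatorname{int}(\operatorname{dom} L)$ tends to a boundary point). $R:\Omega_d\times\mathbb{R}^m\to\mathbb{R}\cup\{+\infty\}$ is a Carathéodory function such that for a.e. $x$, $R(x,\cdot)$ is a Legendre function with $\operatorname{dom}R(x,\cdot)=C(x)$ which is supercoercive: $R(x,y)/|y|\to\infty$ as $|y|\to\infty$. $R^*(x,\cdot)$ is the convex conjugate of $R(x,\cdot)$; $\mathcal{R}(w)(x)=R(x,w(x))$, $\nabla\mathcal{R}(w)(x)=\partial_uR(x,w(x))$, $\nabla\mathcal{R}^*(\psi)(x)=\partial_zR^*(x,\psi(x))$.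 One has $\nabla\mathcal{R}^*=(\nabla\mathcal{R})^{-1}$. Standing convention: $\nabla\mathcal{R}^*$ is well defined and continuous on $L^\infty(\Omega_d;\mathbb{R}^m)$, maps it into $\mathcal{O}$, and $\nabla\mathcal{R}^*(\psi)(x)\in\operatorname{int}C(x)$ a.e. for $\psi\in L^\infty$. The Bregman distance is the pointwise nonnegative function $\mathcal{D}(u,v)=\mathcal{R}(u)-\mathcal{R}(v)-\nabla\mathcal{R}(v)\cdot(u-v)$, and $(\mathcal{D}(u,v),1)_{\Omega_d}\in[0,\infty]$ is its integral over $\Omega_d$. Under these assumptions the discrete problems in the claim are uniquely solvable for every $k\ge1$. *)

(* Defs.v *)
From HB Require Import structures.
From mathcomp Require Import all_boot all_order all_algebra.
From mathcomp Require Import all_classical all_reals all_analysis.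
From mathcomp Require Import measurable_realfun.

Set Implicit Arguments.
Unset Strict Implicit.
Unset Printing Implicit Defensive.

Import Order.TTheory GRing.Theory Num.Theory.
Import numFieldNormedType.Exports.

Local Open Scope classical_set_scope.
Local Open Scope ring_scope.

(* Topological notions on 'rV[R]_n come from the (equivalent) maximum norm of
   the library; every metric quantity uses the Euclidean norm below. *)
Section Euclidean.
Context {R : realType} {n : nat}.
Implicit Types x y : 'rV[R]_n.

Definition dotv x y : R := \sum_i x ord0 i * y ord0 i.

Definition enorm x : R := Num.sqrt (dotv x x).

Definition ediam (U : set 'rV[R]_n) : \bar R :=
  ereal_sup [set (enorm (x.1 - x.2))%:E | x in U `*` U].

End Euclidean.

Section Hausdorff.
Context {R : realType} {n : nat}.
Implicit Types (s delta : R) (A U : set 'rV[R]_n).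
Local Open Scope ereal_scope.

(* pi^(s/2) / Gamma(s/2 + 1): for an integer s, the volume of the unit ball of
   R^s, so that the n-dimensional Hausdorff measure is the Lebesgue measure *)
Definition unit_ball_volume s : R :=
  ((pi `^ (s / 2)) /
   (\int[@lebesgue_measure R]_(t in `]0%R, +oo[) (t `^ (s / 2) * expR (- t))))%R.

(* for s = 0, powR gives 1 on every nonempty set, hence the case U = set0 *)
Definition hausdorff_weight s U : \bar R :=
  if `[< U = set0 >] then 0
  else (unit_ball_volume s * ((fine (ediam U) / 2) `^ s))%:E.

Definition hausdorff_pre s delta A : \bar R :=
  ereal_inf [set \sum_(k <oo) hausdorff_weight s (U k) |
    U in [set U : nat -> set 'rV[R]_n |
            A `<=` \bigcup_k U k /\ forall k, ediam (U k) <= delta%:E]].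

Definition hausdorff s A : \bar R :=
  ereal_sup [set hausdorff_pre s delta A | delta in [set delta | (0 < delta)%R]].

Definition hausdorff_dim A : \bar R :=
  ereal_inf [set s%:E | s in [set s | (0 <= s)%R /\ hausdorff s A = 0]].

Lemma unit_ball_volume_ge0 s : (0 <= unit_ball_volume s)%R.
Proof.
rewrite /unit_ball_volume divr_ge0 ?powR_ge0//.
by apply: Rintegral_ge0 => t _; rewrite mulr_ge0 ?powR_ge0 ?expR_ge0.
Qed.

Lemma hausdorff_weight_ge0 s U : 0 <= hausdorff_weight s U.
Proof.
rewrite /hausdorff_weight; case: ifP => // _.
by rewrite lee_fin mulr_ge0 ?powR_ge0 ?unit_ball_volume_ge0.
Qed.

Let discrete := g_sigma_algebraType (@setT (set 'rV[R]_n)).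

Let weight_le s delta (U : set discrete) : \bar R :=
  if ediam (U : set 'rV[R]_n) <= delta%:E then hausdorff_weight s U else +oo.

Let weight_le_ge0 s delta U : 0 <= weight_le s delta U.
Proof.
by rewrite /weight_le; case: ifP => // _; exact: hausdorff_weight_ge0.
Qed.

Let weight_le0 s delta : weight_le s delta set0 = 0.
Proof.
rewrite /weight_le /hausdorff_weight asboolT//.
case: ifPn => // /negP[]; rewrite /ediam set0X image_set0 ereal_sup0.
by rewrite leNye.
Qed.

Let hausdorff_preE s delta A :
  hausdorff_pre s delta A = mu_ext (weight_le s delta) A.
Proof.
apply/eqP; rewrite eq_le; apply/andP; split; last first.
  apply: le_ereal_inf_tmp => _ [U [AU dU] <-].
  apply: ereal_inf_lbound; exists U.
    by split=> // i; exact: sub_gen_smallest.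
  by apply: eq_eseriesr => k _; rewrite /weight_le dU.
apply: le_ereal_inf_tmp => _ [U [_ AU] <-].
have [dU|/existsNP[k /negP dUk]] :=
    pselect (forall k, ediam (U k : set 'rV[R]_n) <= delta%:E).
  apply: ereal_inf_lbound; exists U => //.
  by apply: eq_eseriesr => k _; rewrite /weight_le dU.
suff -> : \sum_(k <oo) weight_le s delta (U k) = +oo by rewrite leey.
apply/eqP; rewrite eq_le leey/=.
rewrite (nneseries_split 0 k.+1); last first.
  by move=> *; exact: weight_le_ge0.
rewrite add0n big_nat_recr//= {2}/weight_le (negbTE dUk).
rewrite addey ?addye ?leey//.
- rewrite gt_eqF// (lt_le_trans ltNy0)//.
  by apply: nneseries_ge0 => *; exact: weight_le_ge0.
- rewrite gt_eqF// (lt_le_trans ltNy0)//.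
  by apply: sume_ge0 => *; exact: weight_le_ge0.
Qed.

Lemma hausdorff_ge0 s A : 0 <= hausdorff s A.
Proof.
apply: le_ereal_sup_tmp; exists (hausdorff_pre s 1 A).
  by exists 1%R => //=; rewrite ltr01.
by rewrite hausdorff_preE; apply: mu_ext_ge0; exact: weight_le_ge0.
Qed.

Lemma hausdorff0 s : hausdorff s set0 = 0.
Proof.
apply/eqP; rewrite eq_le hausdorff_ge0 andbT.
apply: ge_ereal_sup => _ [delta _ <-].
by rewrite hausdorff_preE mu_ext0//; exact: weight_le_ge0.
Qed.

Lemma le_hausdorff s : {homo hausdorff s : A B / A `<=` B >-> A <= B}.
Proof.
move=> A B AB; apply: ge_ereal_sup => _ [delta d0 <-].
apply: le_ereal_sup_tmp; exists (hausdorff_pre s delta B); first by exists delta.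
by rewrite !hausdorff_preE; exact: le_mu_ext.
Qed.

Lemma hausdorff_sigma_subadditive s : sigma_subadditive (hausdorff s).
Proof.
move=> F; apply: ge_ereal_sup => _ [delta d0 <-]; rewrite hausdorff_preE.
apply: le_trans (mu_ext_sigma_subadditive _ _) _.
  exact: weight_le_ge0.
apply: lee_nneseries => k *.
  by apply: mu_ext_ge0; exact: weight_le_ge0.
by rewrite -hausdorff_preE; apply: ereal_sup_ubound; exists delta.
Qed.

HB.instance Definition _ s := isOuterMeasure.Build R 'rV[R]_n (hausdorff s)
  (hausdorff0 s) (hausdorff_ge0 s) (@le_hausdorff s)
  (@hausdorff_sigma_subadditive s).

End Hausdorff.

(* R^n with the Hausdorff-measurable sets, i.e., the sets that are
   Caratheodory-measurable for the s-dimensional Hausdorff outer measure *)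
Notation hspace n s := (caratheodory_type (@hausdorff _ n s)).

Definition hmeasure (R : realType) (n : nat) (s : R) :
    {measure set (hspace n s) -> \bar R} :=
  let mu : {outer_measure set 'rV[R]_n -> \bar R} := @hausdorff R n s in
  (mu : set (caratheodory_type mu) -> \bar R).

(* Near each boundary point, up to an orthogonal change of coordinates,
   Omega is the strict epigraph, in the i-th direction, of a Lipschitz
   function of the other n - 1 coordinates. *)
Definition bounded_lipschitz_domain (R : realType) (n : nat)
    (Omega : set 'rV[R]_n) :=
  [/\ Omega !=set0, open Omega, connected Omega, bounded_set Omega &
    forall z, (closure Omega `\` Omega°) z ->
    exists (O : 'M[R]_n) (i : 'I_n) (gamma : 'rV[R]_n.-1 -> R) (k r : R),
      [/\ O *m O^T = 1%:M, 0 < r,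
          forall a b, `|gamma a - gamma b| <= k * enorm (a - b) &
          forall x, enorm (x - z) < r ->
            (Omega x <-> gamma (col' i (x *m O)) < (x *m O) ord0 i)]].

Definition is_inner_product (R : realType) (V : normedModType R)
    (ip : V -> V -> R) :=
  [/\ forall x y, ip x y = ip y x,
      forall a x y z, ip (a *: x + y) z = a * ip x z + ip y z &
      forall x, ip x x = `|x| ^+ 2].

Definition fin_dim_subspace (R : realType) (V : lmodType R) (W : set V) :=
  exists N (e : 'I_N -> V),
    forall v, W v <-> exists c : 'I_N -> R, v = \sum_i c i *: e i.

(* Elements of L^p(D; R^m) are represented by functions on T, of which only
   the values on D matter, taken up to equality mu-almost everywhere on D. *)
Section VectorLp.
Context d {T : measurableType d} {R : realType} {m : nat}.
Variables (mu : {measure set T -> \bar R}) (D : set T).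
Implicit Types f g : T -> 'rV[R]_m.

Definition vmeasurable f := forall i, measurable_fun D (fun x => f x ord0 i).

Definition L2 f :=
  vmeasurable f /\ (\int[mu]_(x in D) (enorm (f x) ^+ 2)%:E < +oo)%E.

Definition Linfty f :=
  vmeasurable f /\ exists M, \forall x \ae mu, D x -> enorm (f x) <= M.

Definition l2ip f g : R := \int[mu]_(x in D) dotv (f x) (g x).

Definition l2norm f : R := Num.sqrt (l2ip f f).

Definition L2_dense_embedding (Q : normedModType R)
    (iota : Q -> T -> 'rV[R]_m) :=
  [/\ forall q, L2 (iota q),
      forall a p q,
        iota (a *: p + q) = a *: iota p + iota q %[ae mu in D],
      forall q, iota q = 0 %[ae mu in D] -> q = 0,
      exists c, forall q, l2norm (iota q) <= c * `|q| &
      forall f, L2 f -> forall e, 0 < e -> exists q, l2norm (f - iota q) < e].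

(* W is the set of all representatives of the elements of a finite-dimensional
   subspace of L^infty(D; R^m).  The inner products with elements of W need
   W to be contained in L^2 too, which follows when mu D is finite. *)
Definition fin_dim_Linfty_subspace (W : set (T -> 'rV[R]_m)) :=
  exists N (e : 'I_N -> T -> 'rV[R]_m),
    (forall i, Linfty (e i) /\ L2 (e i)) /\
    forall f, W f <->
      exists c : 'I_N -> R, f = \sum_i c i *: e i %[ae mu in D].

(* the norm in Q' of w in L^2 *)
Definition l2_dual_norm (Q : normedModType R) (iota : Q -> T -> 'rV[R]_m)
    (w : T -> 'rV[R]_m) : R :=
  sup [set `|l2ip w (iota q)| | q in [set q | `|q| <= 1]].

Definition infsup_const (V Q : normedModType R) (iota : Q -> T -> 'rV[R]_m)
    (B : V -> Q) (Vh : set V) (Wh : set (T -> 'rV[R]_m)) : \bar R :=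
  ereal_inf [set ereal_sup
    [set (l2ip (iota (B v)) w / (`|v| * l2_dual_norm iota w))%:E |
       v in Vh `&` [set v | v != 0]] |
    w in Wh `&` [set w | ~ (w = 0 %[ae mu in D])]].

End VectorLp.

Section ConvexAnalysis.
Context {R : realType} {m : nat}.
Implicit Types (f : 'rV[R]_m -> \bar R) (y z : 'rV[R]_m).
Local Open Scope ereal_scope.

Definition edom f : set 'rV[R]_m := [set y | f y < +oo].

(* gradient of f at a point near which f is finite *)
Definition egrad f y : 'rV[R]_m :=
  \row_i 'D_(delta_mx ord0 i) (fine \o f : 'rV[R]_m -> R^o) y.

Definition ediff f y := differentiable (fine \o f : 'rV[R]_m -> R^o) y.

Definition econvex f := forall y z (t : R), (0 <= t <= 1)%R ->
  f (t *: y + (1 - t) *: z)%R <= t%:E * f y + (1 - t)%:E * f z.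

Definition estrictly_convex_on (A : set 'rV[R]_m) f :=
  forall y z (t : R), A y -> A z -> y != z -> (0 < t < 1)%R ->
  f (t *: y + (1 - t) *: z)%R < t%:E * f y + (1 - t)%:E * f z.

Record legendre f : Prop := Legendre {
  legendre_nNy : forall y, f y != -oo ;
  legendre_convex : econvex f ;
  legendre_closed : lower_semicontinuous f ;
  (* together with legendre_nNy, implies that f is proper *)
  legendre_int : (edom f)° !=set0 ;
  legendre_strict : estrictly_convex_on (edom f)° f ;
  legendre_diff : forall y, (edom f)° y -> ediff f y ;
  legendre_singular : forall (u : nat -> 'rV[R]_m) y,
    (forall j, (edom f)° (u j)) ->
    (closure (edom f) `\` (edom f)°) y ->
    u @ \oo --> y ->
    enorm (egrad f (u j)) @[j --> \oo] --> +oo%R }.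

Definition supercoercive f := forall M : R, exists r : R,
  forall y, (r < enorm y)%R -> (M * enorm y)%:E <= f y.

Definition econj f z : \bar R :=
  ereal_sup [set (dotv z y)%:E - f y | y in setT].

End ConvexAnalysis.

Section Superposition.
Context d {T : measurableType d} {R : realType} {m : nat}.
Variables (mu : {measure set T -> \bar R}) (D : set T).
Variables (C : T -> set 'rV[R]_m) (Rf : T -> 'rV[R]_m -> \bar R).
Implicit Types psi : T -> 'rV[R]_m.

(* As Rf takes the value +oo off its domain, continuity in the second argument
   is meant on the effective domain. *)
Definition caratheodory_fun :=
  (forall y, measurable_fun D (Rf^~ y)) /\
  \forall x \ae mu, D x -> {within edom (Rf x), continuous (Rf x)}.

Definition feasible_obs : set (T -> 'rV[R]_m) :=
  [set o | L2 mu D o /\ \forall x \ae mu, D x -> C x (o x)].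

Definition nabla_conj psi : T -> 'rV[R]_m :=
  fun x => egrad (econj (Rf x)) (psi x).

(* the map psi |-> nabla R^*(psi) is well defined and continuous on L^infty,
   with values in feasible_obs and, pointwise, in the interior of C *)
Definition nabla_conj_regular :=
  [/\ forall psi, Linfty mu D psi ->
        \forall x \ae mu, D x -> ediff (econj (Rf x)) (psi x),
      forall psi, Linfty mu D psi -> feasible_obs (nabla_conj psi),
      forall psi, Linfty mu D psi ->
        \forall x \ae mu, D x -> (C x)° (nabla_conj psi x) &
      forall psi, Linfty mu D psi -> forall e, 0 < e ->
        exists2 delta, 0 < delta & forall phi, Linfty mu D phi ->
          (\forall x \ae mu, D x -> enorm (phi x - psi x) <= delta) ->
          l2norm mu D (nabla_conj phi - nabla_conj psi) < e].

Definition bregman (u v : T -> 'rV[R]_m) (x : T) : \bar R :=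
  (Rf x (u x) - Rf x (v x) -
    (dotv (egrad (Rf x) (v x)) (u x - v x))%:E)%E.

End Superposition.

Definition feasible_set d (T : measurableType d) (R : realType) (m : nat)
    (mu : {measure set T -> \bar R}) (D : set T) (C : T -> set 'rV[R]_m)
    (V Q : Type) (iota : Q -> T -> 'rV[R]_m) (B : V -> Q) : set V :=
  [set v | \forall x \ae mu, D x -> C x (iota (B v) x)].

Definition weighted_mean (R : realType) (V : lmodType R)
    (alpha : nat -> R) (u : nat -> V) (l : nat) : V :=
  (\sum_(1 <= k < l.+1) alpha k)^-1 *: \sum_(1 <= k < l.+1) alpha k *: u k.

(* Main.v *)
Require Import Defs.
From mathcomp Require Import all_boot all_order all_algebra.
From mathcomp Require Import all_classical all_reals all_analysis.
From mathcomp Require Import measurable_realfun.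
From mathcomp Require Import ring lra.
Import Order.TTheory GRing.Theory Num.Theory.
Import numFieldNormedType.Exports.
Local Open Scope classical_set_scope.
Local Open Scope ring_scope.

(* Testing the [k]-th step with [u_k - Pi_h us] and using the Fortin property
   turns [alpha_k (A(u_k, u_k - Pi_h us) - F(u_k - Pi_h us))] into
   [(o_k - os, psi_(k-1) - psi_k)].  Since [psi_k] is the gradient of [R] at
   [o_k], the three-point identity makes this telescope, up to nonpositive
   Bregman terms, to at most the integral of [D(os, o_0)].  Jensen's inequality
   passes to the weighted mean, and coercivity, Young's inequality and the
   variational inequality give the estimate. *)

Set Implicit Arguments.
Unset Strict Implicit.

(** * Euclidean inner product and norm *)

Section dotv_theory.
Context {R : realType} {n : nat}.
Implicit Types x y z : 'rV[R]_n.

Lemma dotvC x y : dotv x y = dotv y x.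
Proof. by apply: eq_bigr => i _; rewrite mulrC. Qed.

Lemma dotvDl x y z : dotv (x + y) z = dotv x z + dotv y z.
Proof. by rewrite -big_split; apply: eq_bigr => i _; rewrite mxE mulrDl. Qed.

Lemma dotvZl (a : R) x z : dotv (a *: x) z = a * dotv x z.
Proof. by rewrite /dotv mulr_sumr; apply: eq_bigr => i _; rewrite mxE mulrA. Qed.

Lemma dotvNl x z : dotv (- x) z = - dotv x z.
Proof. by rewrite -scaleN1r dotvZl mulN1r. Qed.

Lemma dotvBl x y z : dotv (x - y) z = dotv x z - dotv y z.
Proof. by rewrite dotvDl dotvNl. Qed.

Lemma dotvDr x y z : dotv z (x + y) = dotv z x + dotv z y.
Proof. by rewrite dotvC dotvDl !(dotvC z). Qed.

Lemma dotvZr (a : R) x z : dotv z (a *: x) = a * dotv z x.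
Proof. by rewrite dotvC dotvZl dotvC. Qed.

Lemma dotvBr x y z : dotv z (x - y) = dotv z x - dotv z y.
Proof. by rewrite dotvC dotvBl !(dotvC z). Qed.

Lemma dotv_delta x i : dotv x (delta_mx ord0 i) = x ord0 i.
Proof.
rewrite /dotv (bigD1 i)//= big1 ?addr0 => [|j ji].
  by rewrite mxE !eqxx mulr1.
by rewrite mxE (negbTE ji) andbF mulr0.
Qed.

Lemma dotv_ge0 x : 0 <= dotv x x.
Proof. by apply: sumr_ge0 => i _; rewrite -expr2 sqr_ge0. Qed.

Lemma sqr_enorm x : enorm x ^+ 2 = dotv x x.
Proof. by rewrite sqr_sqrtr// dotv_ge0. Qed.

Lemma norm_coord_le_enorm x i : `|x ord0 i| <= enorm x.
Proof.
rewrite -(@ler_pXn2r _ 2)// ?nnegrE ?sqrtr_ge0// sqr_enorm real_normK ?num_real//.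
rewrite /dotv (bigD1 i)//= expr2 lerDl.
by apply: sumr_ge0 => j _; rewrite -expr2 sqr_ge0.
Qed.

(** A weak Cauchy-Schwarz inequality: each coordinate of [y] is at most [enorm y]. The 1-norm of [x]
    as constant is enough to set supercoercivity against a linear form. *)
Lemma dotv_le_enorm x y : dotv x y <= (\sum_i `|x ord0 i|) * enorm y.
Proof.
rewrite mulr_suml; apply: ler_sum => i _.
rewrite (le_trans (ler_norm _))// normrM ler_wpM2l//.
exact: norm_coord_le_enorm.
Qed.

(** Termwise, a product is at most a sum of squares; this is the integrable majorant for inner
    products of [L^2] fields. *)
Lemma norm_dotv_le x y :
  `|dotv x y| <= enorm x ^+ 2 + enorm y ^+ 2.
Proof.
rewrite !sqr_enorm /dotv -big_split/= (le_trans (ler_norm_sum _ _ _))//.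
apply: ler_sum => i _; rewrite normrM.
rewrite -[x _ _ * _]expr2 -[y _ _ * _]expr2 -(real_normK (num_real (x _ _))).
by rewrite -(real_normK (num_real (y _ _))); nra.
Qed.

Lemma enorm_le_sum x : enorm x <= \sum_i `|x ord0 i|.
Proof.
have [->|x0] := eqVneq (enorm x) 0; first exact: sumr_ge0.
have xgt0 : 0 < enorm x by rewrite lt_neqAle eq_sym x0 sqrtr_ge0.
by rewrite -(ler_pM2r xgt0) -expr2 sqr_enorm dotv_le_enorm.
Qed.

Lemma dotv_continuous z : continuous (dotv z : 'rV[R]_n -> R).
Proof.
have -> : dotv z = \sum_i (fun y : 'rV[R]_n => z ord0 i * y ord0 i).
  by apply/funext => y; rewrite fct_sumE.
elim/big_ind : _ => [|f g cf cg|i _] x.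
- by apply: cst_continuous.
- exact: cvgD (cf x) (cg x).
- by apply: continuousM; [exact: cst_continuous|exact: coord_continuous].
Qed.

End dotv_theory.

(** If the infimum [I] were not attained, the sublevel sets of [h] in [K] at real levels above [I]
    would generate a proper filter. At a cluster point [h] exceeds [I], and by lower semicontinuity
    a neighbourhood misses one of these sets. *)
Lemma compact_lsc_min (R : realType) (T : topologicalType) (K : set T)
    (h : T -> \bar R) : compact K -> K !=set0 -> lower_semicontinuous h ->
  exists2 y, K y & forall x, K x -> (h y <= h x)%E.
Proof.
move=> cK [x0 Kx0] lsch; set I := ereal_inf (h @` K).
have IleP x : K x -> (I <= h x)%E by move=> Kx; apply: ereal_inf_lbound; exists x.
have [[y Ky hy]|noty] := pselect (exists2 y, K y & (h y <= I)%E).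
  by exists y => // x Kx; exact: le_trans (IleP _ Kx).
have IltP x : K x -> (I < h x)%E.
  by move=> Kx; rewrite ltNge; apply/negP => hx; apply: noty; exists x.
(* [I] may be [-oo] and [e] may be [+oo], so a midpoint is not always available. *)
have between (e : \bar R) : (I < e)%E -> exists2 a : R, (I < a%:E)%E & (a%:E < e)%E.
  case: I e {IleP noty IltP} => [r| |] [s| |]//=.
  - by rewrite lte_fin => rs; exists ((r + s) / 2); rewrite lte_fin ?midf_lt.
  - by exists (r + 1); rewrite ?ltry// lte_fin ltrDl.
  - by exists (s - 1); rewrite ?ltNyr// lte_fin gtrDl ltrN10.
  - by exists 0; rewrite ?ltNyr ?ltry.
pose F := filter_from [set a : R | (I < a%:E)%E]
                      (fun a => K `&` [set y | (h y <= a%:E)%E]).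
have FF : ProperFilter F.
  apply: filter_from_proper; last first.
    move=> a /= /ereal_inf_lt [_ [y Ky <-] hya].
    by exists y; split => //=; exact: ltW.
  apply: filter_from_filter.
    by have [a Ia _] := between _ (IltP _ Kx0); exists a.
  move=> a b /= Ia Ib; exists (Num.min a b).
    by rewrite /= /Num.min; case: ifP.
  move=> y [Ky /=]; rewrite EFin_min le_min => /andP[ya yb].
  by split; split.
have FK : F K.
  have [a Ia _] := between _ (IltP _ Kx0).
  by exists a => // y [].
have [p [Kp clp]] := cK F FF FK.
have [a Ia ap] := between _ (IltP _ Kp).
have [V pV Va] := lsch _ _ ap.
have [y [[Ky /= ya] Vy]] := clp _ _ (ex_intro2 _ _ a Ia (fun _ x => x)) pV.
by have := Va _ Vy; rewrite ltNge ya.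
Qed.

(** * Subgradients and the gradient of the convex conjugate *)

Section convex_duality.
Context {R : realType} {m : nat}.
Implicit Types (f : 'rV[R]_m -> \bar R) (g : 'rV[R]_m -> R^o).
Implicit Types x y z o : 'rV[R]_m.

(** The slope [z] lies in the subdifferential of [f] at [y]. When [f] takes a value below [+oo],
    this forces [f y < +oo]. *)
Definition subgradient f y z :=
  forall x, (f y + (dotv z (x - y))%:E <= f x)%E.

(** A minimizer of [h = f - dotv z] admits [z] as subgradient of [f]. Supercoercivity keeps a
    sublevel set of [h] inside a compact cube. *)
Lemma supercoercive_subgradient f z : (forall y, f y != -oo%E) ->
  lower_semicontinuous f -> edom f !=set0 -> supercoercive f ->
  exists2 y, edom f y & subgradient f y z.
Proof.
move=> fNy lscf [x0 fx0] supf.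
have fx0E : f x0 = (fine (f x0))%:E.
  by rewrite fineK// fin_numE fNy/= lt_eqF.
pose h y := (f y - (dotv z y)%:E)%E.
pose a0 := fine (f x0) - dotv z x0.
have hx0 : h x0 = a0%:E by rewrite /h fx0E.
have lsch : lower_semicontinuous h.
  move=> x a; rewrite /h lteBrDr// -EFinD => afx.
  (* [b] splits the gap: near [x], [f] stays above [b] and [dotv z] below [b - a]. *)
  have [b ab bfx] : exists2 b, a + dotv z x < b & (b%:E < f x)%E.
    case: (f x) afx => [r| |]//.
      rewrite lte_fin => ar; exists ((a + dotv z x + r) / 2).
        by rewrite (midf_lt ar).
      by rewrite lte_fin (midf_lt ar).
    by exists (a + dotv z x + 1); rewrite ?ltry// ltrDl.
  have [V xV Vf] := lscf _ _ bfx.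
  have dz := @dotv_continuous _ _ z x.
  exists (V `&` [set y | dotv z y < b - a]).
    apply: filterI => //; apply: (cvgr_lt _ dz).
    by rewrite ltrBrDl.
  move=> y [Vy yba]; rewrite lteBrDr//; apply: le_lt_trans (Vf _ Vy).
  rewrite -EFinD lee_fin -lerBrDl; exact: ltW.
(* Beyond radius [r] this slope gives [h y >= enorm y], so [h y <= a0] forces
   [enorm y <= max r a0]. *)
have [r hr] := supf (\sum_i `|z ord0 i| + 1).
pose rho := Num.max r a0.
pose K := [set y : 'rV[R]_m | forall i, y ord0 i \in `[- rho, rho]].
have cK : compact K.
  apply: (@rV_compact _ _ (fun=> `[- rho, rho]%classic)) => _.
  exact: segment_compact.
have Kh y : (h y <= a0%:E)%E -> K y.
  move=> hya i; rewrite in_itv/= -ler_norml.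
  apply: le_trans (norm_coord_le_enorm _ _) _.
  rewrite /rho le_max; have [//|ry] := leP (enorm y) r.
  move: hya; rewrite /h leeBlDr// -EFinD => /(le_trans (hr _ ry)).
  rewrite lee_fin mulrDl mul1r addrC.
  by have := dotv_le_enorm z y; lra.
have Kx0 : K x0 by apply: Kh; rewrite hx0.
have [y Ky hmin] := @compact_lsc_min _ _ K h cK (ex_intro _ x0 Kx0) lsch.
have {}hmin x : (h y <= h x)%E.
  have [/Kh/hmin//|/ltW xa] := leP (h x) a0%:E.
  by apply: le_trans xa; rewrite -hx0; exact: hmin.
exists y => [|x].
  rewrite /edom/= ltey; apply/eqP => fy.
  by have := hmin x0; rewrite hx0 /h fy.
have := hmin x; rewrite /h dotvBr EFinB.
case: (f y) (f x) (fNy y) (fNy x) => [s| |] [t| |]//= _ _;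
  last by move=> _; exact: leey.
by rewrite -!EFinB -EFinD !lee_fin; lra.
Qed.

(** The difference quotient along a basis vector is at least the coordinate of [z] for [h > 0] and
    at most it for [h < 0]; differentiability makes both one-sided limits equal. *)
Lemma gradient_touching_below g x z : differentiable g x ->
  (\forall y \near x, g x + dotv z (y - x) <= g y) ->
  \row_i 'D_(delta_mx ord0 i) g x = z.
Proof.
move=> dg gz; apply/rowP => i; rewrite mxE -(dotv_delta z).
set v := delta_mx _ _.
have cg : cvg ((fun h : R => h^-1 *: ((g \o shift x) (h *: v) - g x)) @ 0^').
  exact: diff_derivable.
have gap : \forall h \near (0 : R),
    h * dotv z v <= (g \o shift x) (h *: v) - g x.
  have hx : (fun h : R => h *: v + x) @ (0 : R) --> x.
    rewrite -[X in _ --> X]add0r -(scale0r v).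
    by apply: cvgD; [exact: scalel_continuous|exact: (cvg_cst x)].
  have : \forall h \near (0 : R),
    g x + dotv z (h *: v + x - x) <= g (h *: v + x) by exact: hx _ gz.
  apply: filterS => h /=.
  by rewrite addrK dotvZr; lra.
apply/eqP; rewrite eq_le; apply/andP; split.
- rewrite /derive (cvg_at_leftE _ _ cg); apply: limr_le.
    by apply: (cvgP ('D_v g x)); exact: cvg_dnbhs_at_left.
  near=> h; have h0 : h < 0 by near: h; exact: nbhs_left_lt.
  rewrite /GRing.scale/= mulrC ler_ndivrMr// mulrC.
  by near: h; exact: cvg_within gap.
- rewrite /derive (cvg_at_rightE _ _ cg); apply: limr_ge.
    by apply: (cvgP ('D_v g x)); exact: cvg_dnbhs_at_right.
  near=> h; have h0 : 0 < h by near: h; exact: nbhs_right_gt.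
  rewrite /GRing.scale/= mulrC ler_pdivlMr// mulrC.
  by near: h; exact: cvg_within gap.
Unshelve. all: by end_near. Qed.

(** Near an interior point of its domain [f] is real-valued, so its affine minorant touches a real
    function from below. This later identifies the gradient of [R] at [o_0] with [psi_0]. *)
Lemma egrad_subgradient f x z : (forall y, f y != -oo%E) ->
  (edom f)° x -> ediff f x -> subgradient f x z -> egrad f x = z.
Proof.
move=> fNy fx dfx subx; apply: gradient_touching_below => //.
have fE y : edom f y -> f y = (fine (f y))%:E.
  by move=> fy; rewrite fineK// fin_numE fNy/= lt_eqF.
have fx' : edom f x by exact: nbhs_singleton fx.
apply: filterS fx => y fy.
by have := subx y; rewrite (fE y fy) (fE x fx') -EFinD lee_fin.
Qed.

(* A maximizer [y] of [dotv z - f] is the slope of an affine minorant of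
   [econj f] touching it at [z], hence its gradient there. *)
Lemma egrad_econj_subgradient f z : legendre f -> supercoercive f ->
  ediff (econj f) z -> subgradient f (egrad (econj f) z) z.
Proof.
move=> legf supf dfz.
have fNy := legendre_nNy legf.
have f0 : edom f !=set0.
  by have [y /interior_subset] := legendre_int legf; exists y.
(* Fenchel equality: a point where [w] is a subgradient attains the supremum that defines
   [econj f w]. *)
have maxf w : exists2 y, econj f w = (dotv w y - fine (f y))%:E &
    edom f y /\ subgradient f y w.
  have [y fy suby] :=
    supercoercive_subgradient w fNy (legendre_closed legf) f0 supf.
  have fyE : f y = (fine (f y))%:E by rewrite fineK// fin_numE fNy/= lt_eqF.
  exists y => //; apply/eqP; rewrite eq_le; apply/andP; split.
    apply: ge_ereal_sup => _ [x _ <-].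
    have := suby x; rewrite fyE /= -EFinD dotvBr.
    case: (f x) (fNy x) => [t| |]//= _; last by rewrite leNye.
    by rewrite -EFinB !lee_fin; lra.
  by apply: ereal_sup_ubound; exists y => //; rewrite fyE.
have [y yE [fy suby]] := maxf z.
have fyE : f y = (fine (f y))%:E by rewrite fineK// fin_numE fNy/= lt_eqF.
suff -> : egrad (econj f) z = y by [].
apply: (gradient_touching_below dfz); near=> w => /=; rewrite yE.
(* [maxf w] also shows that [econj f w] is finite, so that [fine] keeps the inequality. *)
have [v wE _] := maxf w; have : ((dotv w y)%:E - f y <= econj f w)%E.
  by apply: ereal_sup_ubound; exists y.
by rewrite wE fyE/= -EFinB lee_fin dotvBr !(dotvC y); lra.
Unshelve. all: by end_near. Qed.

End convex_duality.

(** * Telescoping of Bregman distances *)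

Section three_point.
Context {R : realType} {m : nat}.
Implicit Types (f : 'rV[R]_m -> \bar R) (v : 'rV[R]_m).

(* The three-point identity for the Bregman distances [D(v, o k)] and
   [D(o k.+1, o k)], telescoped; all of them are nonnegative. *)
Lemma bregman_telescope f v (o psi : nat -> 'rV[R]_m) l :
  (forall y, f y != -oo%E) -> edom f v ->
  (forall k, (k <= l)%N -> subgradient f (o k) (psi k)) ->
  ((\sum_(k < l) dotv (o k.+1 - v) (psi k - psi k.+1))%:E <=
   f v - f (o 0%N) - (dotv (psi 0%N) (v - o 0%N))%:E)%E.
Proof.
move=> fNy fv subo.
have fE y : edom f y -> f y = (fine (f y))%:E.
  by move=> fy; rewrite fineK// fin_numE fNy/= lt_eqF.
(* The subgradient inequality tested at [v], where [f] is finite, bounds [f (o k)]. *)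
have fo k : (k <= l)%N -> f (o k) = (fine (f (o k)))%:E.
  move=> kl; apply: (fE); have := subo k kl v; rewrite (fE _ fv) /edom/=.
  by case: (f (o k)) (fNy (o k)) => [r| |]//= _; rewrite ltry.
have step k : (k < l)%N ->
    fine (f (o k)) + dotv (psi k) (o k.+1 - o k) <= fine (f (o k.+1)).
  move=> kl; have := subo k (ltnW kl) (o k.+1).
  by rewrite (fo k (ltnW kl)) (fo _ kl) -EFinD lee_fin.
(* The right-hand side is [D(v, o 0) - D(v, o j)] with [psi] as gradients; [D(v, o l) >= 0] finishes
   the proof. *)
have tele j : (j <= l)%N ->
    \sum_(k < j) dotv (o k.+1 - v) (psi k - psi k.+1) <=
    fine (f (o j)) + dotv (psi j) (v - o j)
    - fine (f (o 0%N)) - dotv (psi 0%N) (v - o 0%N).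
  elim: j => [_|j IH jl]; first by rewrite big_ord0; lra.
  rewrite big_ord_recr/=; have := IH (ltnW jl); have := step j jl.
  rewrite !dotvBl !dotvBr !(dotvC _ (psi j)) !(dotvC _ (psi j.+1)).
  by lra.
rewrite (fE v fv) (fo 0%N)// -!EFinB lee_fin.
apply: le_trans (tele l (leqnn l)) _.
have := subo l (leqnn l) v; rewrite (fo l)// (fE v fv) -EFinD lee_fin.
by lra.
Qed.

End three_point.

(** * Integral comparison for possibly nonmeasurable functions *)

Section integral_nonmeasurable.
Local Open Scope ereal_scope.
Context d {T : measurableType d} {R : realType}.
Variable mu : {measure set T -> \bar R}.
Implicit Types (D : set T) (f : T -> \bar R).

(** The integral of a nonnegative function is a supremum over simple functions below it, hence
    monotone without measurability. *)
Lemma ge0_le_integral_patch D1 D2 f1 f2 :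
  (forall x, D1 x -> 0 <= f1 x) -> (forall x, D2 x -> 0 <= f2 x) ->
  (forall x, (f1 \_ D1) x <= (f2 \_ D2) x) ->
  \int[mu]_(x in D1) f1 x <= \int[mu]_(x in D2) f2 x.
Proof.
move=> f10 f20 f12; rewrite !ge0_integralE//.
apply: le_ereal_sup => _ [h hf1 <-]; exists h => // x.
exact: le_trans (hf1 x) (f12 x).
Qed.

(* [f] need not be measurable, in which case its integral is a lower one. *)
Lemma integrable_le_integral D (g : T -> R) f : measurable D ->
  mu.-integrable D (EFin \o g) ->
  (\forall x \ae mu, D x -> 0 <= f x /\ (g x)%:E <= f x) ->
  \int[mu]_(x in D) (g x)%:E <= \int[mu]_(x in D) f x.
Proof.
move=> mD ig [N [mN N0 subN]].
have fN x : D x -> ~ N x -> 0 <= f x /\ (g x)%:E <= f x.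
  by move=> Dx Nx; apply: contrapT => fx; apply/Nx/subN => /(_ Dx).
(* On [D] the negative part of [f] vanishes off the null set [N]; comparison with [+oo] on [N] makes
   its integral zero. *)
have -> : \int[mu]_(x in D) f x = \int[mu]_(x in D) f^\+ x.
  rewrite integralE [X in _ - X](_ : _ = 0) ?sube0//.
  apply/eqP; rewrite eq_le integral_ge0//= andbT.
  have <- : \int[mu]_(x in N) cst +oo x = 0 by rewrite integral_cst// N0 mule0.
  apply: ge0_le_integral_patch => [x _|x _|x]; [exact: funeneg_ge0|exact: leey|].
  rewrite !patchE; have [Nx|/negP Nx] := boolP (x \in N); first by rewrite leey.
  case: ifPn => //; rewrite inE => Dx.
  have [f0 _] := fN x Dx (fun Nx' => Nx (mem_set Nx')).
  by rewrite funenegE max_r// leeNl oppe0.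
have mg := measurable_int mu ig.
rewrite (negligible_integral mN mD ig N0).
have mDN : measurable (D `\` N) by exact: measurableD.
have igN : mu.-integrable (D `\` N) (EFin \o g).
  by apply: (integrableS mD mDN _ ig); exact: subDsetl.
apply: (@le_trans _ _ (\int[mu]_(x in D `\` N) (EFin \o g)^\+ x)).
  apply: le_integral => //; first exact: integrable_funepos.
  by move=> x _; rewrite funeposE le_max lexx.
apply: ge0_le_integral_patch => [x _|x _|x]; do ?exact: funepos_ge0.
rewrite !patchE; case: ifPn; last by case: ifP => // _ _; exact: funepos_ge0.
rewrite inE => -[Dx Nx]; rewrite (mem_set Dx).
have [f0 gf] := fN x Dx Nx.
by rewrite !funeposE ge_max !le_max gf lexx orbT.
Qed.

End integral_nonmeasurable.

(** * Vector fields in [L^2] and [L^infty] *)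

Section L2_theory.
Context d {T : measurableType d} {R : realType} {m : nat}.
Variables (mu : {measure set T -> \bar R}) (D : set T).
Hypothesis mD : measurable D.
Implicit Types f g h : T -> 'rV[R]_m.

Lemma measurable_dotv f g : vmeasurable D f -> vmeasurable D g ->
  measurable_fun D (fun x => dotv (f x) (g x)).
Proof.
by move=> mf mg; apply: measurable_sum => i; exact: measurable_funM.
Qed.

Lemma measurable_sqr_enorm f : vmeasurable D f ->
  measurable_fun D (fun x => (enorm (f x) ^+ 2)%:E).
Proof.
move=> mf; apply/measurable_EFinP; under eq_fun do rewrite sqr_enorm.
exact: measurable_dotv.
Qed.

Lemma integrable_sqr_enorm f : L2 mu D f ->
  mu.-integrable D (EFin \o (fun x => enorm (f x) ^+ 2)).
Proof.
move=> [mf foo]; apply/integrableP; split.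
  exact: measurable_sqr_enorm.
apply: le_lt_trans foo; rewrite le_eqVlt; apply/orP; left; apply/eqP.
by apply: eq_integral => x _ /=; rewrite ger0_norm// sqr_ge0.
Qed.

Lemma integrable_dotv f g : L2 mu D f -> L2 mu D g ->
  mu.-integrable D (EFin \o (fun x => dotv (f x) (g x))).
Proof.
move=> Lf Lg; have [mf _] := Lf; have [mg _] := Lg.
have ifg := integrableD mD (integrable_sqr_enorm Lf) (integrable_sqr_enorm Lg).
apply: le_integrable ifg => //.
  by apply/measurable_EFinP; exact: measurable_dotv.
move=> x _ /=; rewrite lee_fin (le_trans (norm_dotv_le _ _))//.
exact: ler_norm.
Qed.

(** Equality is asked only almost everywhere because [iota] is linear only up to null sets. *)
Lemma l2ip_linearl a f g h w : L2 mu D f -> L2 mu D g -> L2 mu D h ->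
  L2 mu D w -> h = a *: f + g %[ae mu in D] ->
  l2ip mu D h w = a * l2ip mu D f w + l2ip mu D g w.
Proof.
move=> Lf Lg Lh Lw hE.
have ifw := integrable_dotv Lf Lw; have igw := integrable_dotv Lg Lw.
have iafw : mu.-integrable D (EFin \o (fun x => a * dotv (f x) (w x))).
  exact: (integrableZl mD a ifw).
rewrite -RintegralZl// -RintegralD//; congr fine.
apply: ae_eq_integral => //.
- exact: measurable_int (integrable_dotv Lh Lw).
- exact: measurable_int (integrableD mD iafw igw).
- apply: filterS hE => x hx Dx; rewrite hx//.
  by rewrite -dotvZl -dotvDl.
Qed.

Lemma vmeasurable_linear a f g : vmeasurable D f -> vmeasurable D g ->
  vmeasurable D (a *: f + g).
Proof.
move=> mf mg i; under eq_fun do rewrite !mxE.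
by apply: measurable_funD => //; exact: measurable_funM.
Qed.

Lemma L2_linear a f g : L2 mu D f -> L2 mu D g -> L2 mu D (a *: f + g).
Proof.
move=> Lf Lg; have [mf _] := Lf; have [mg _] := Lg.
split; first exact: vmeasurable_linear.
have ifg := integrableD mD
  (integrableZl mD (2 * a ^+ 2) (integrable_sqr_enorm Lf))
  (integrableZl mD 2 (integrable_sqr_enorm Lg)).
apply: (integrable_lty mD); apply: le_integrable ifg => //.
  by apply: measurable_sqr_enorm; exact: vmeasurable_linear.
move=> x _; rewrite -[X in (_ <= `|X|)%E]/((2 * a ^+ 2 * enorm (f x) ^+ 2 +
  2 * enorm (g x) ^+ 2)%:E) !abse_EFin lee_fin (le_trans _ (ler_norm _))//.
rewrite ger0_norm ?sqr_ge0// !sqr_enorm.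
(* Since [|a f - g|^2 >= 0], one has [|a f + g|^2 <= 2 a^2 |f|^2 + 2 |g|^2]. *)
have := dotv_ge0 (a *: f x - g x).
rewrite -[(a *: f + g) x]/(a *: f x + g x) !dotvBl !dotvBr !dotvDl !dotvDr.
by rewrite !dotvZl !dotvZr (dotvC (g x) (f x)); lra.
Qed.

Lemma Linfty_linear a f g : Linfty mu D f -> Linfty mu D g ->
  Linfty mu D (a *: f + g).
Proof.
move=> [mf [M fM]] [mg [N gN]]; split; first exact: vmeasurable_linear.
exists (\sum_(i < m) (`|a| * M + N)); apply: filterS2 fM gN => x fM gN Dx.
apply: le_trans (enorm_le_sum _) _; apply: ler_sum => i _.
rewrite !mxE (le_trans (ler_normD _ _))// lerD//.
  rewrite normrM ler_wpM2l//.
  exact: le_trans (norm_coord_le_enorm _ _) (fM Dx).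
exact: le_trans (norm_coord_le_enorm _ _) (gN Dx).
Qed.

Hypothesis cmu : measure_is_complete mu.

(** By completeness, a change on a null set preserves measurability; membership in the discrete
    space is stable under such changes. *)
Lemma ae_vmeasurable f g : f = g %[ae mu in D] ->
  vmeasurable D f -> vmeasurable D g.
Proof.
move=> fg mf i; apply/measurable_EFinP.
apply: (ae_measurable_fun cmu (f := EFin \o (fun x => f x ord0 i))).
  by apply: filterS fg => x fg Dx /=; rewrite fg.
exact/measurable_EFinP.
Qed.

Lemma ae_L2 f g : f = g %[ae mu in D] -> L2 mu D f -> L2 mu D g.
Proof.
move=> fg Lf; have [mf foo] := Lf; have mg := ae_vmeasurable fg mf.
split => //; apply: le_lt_trans foo; rewrite le_eqVlt.
apply/orP; left; apply/eqP; apply: ge0_ae_eq_integral => //.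
- exact: measurable_sqr_enorm.
- exact: measurable_sqr_enorm.
- by move=> x _; rewrite lee_fin sqr_ge0.
- by move=> x _; rewrite lee_fin sqr_ge0.
- by apply: filterS fg => x fg Dx; rewrite fg.
Qed.

Lemma ae_Linfty f g : f = g %[ae mu in D] -> Linfty mu D f -> Linfty mu D g.
Proof.
move=> fg [mf [M fM]]; split; first exact: ae_vmeasurable fg mf.
by exists M; apply: filterS2 fg fM => x fg fM Dx; rewrite -fg// fM.
Qed.

(** Regularity passes from the spanning family to its combinations by linearity, then to every
    representative by completeness. *)
Lemma fin_dim_Linfty_subspace_regular (W : set (T -> 'rV[R]_m)) f :
  fin_dim_Linfty_subspace mu D W -> W f -> Linfty mu D f /\ L2 mu D f.
Proof.
move=> [N [e [he WE]]] /WE[c fE].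
have [Linf L] : Linfty mu D (\sum_i c i *: e i) /\ L2 mu D (\sum_i c i *: e i).
  have Linf0 : Linfty mu D (0 : T -> 'rV[R]_m).
    split=> [i|].
      rewrite (_ : (fun _ => _) = cst 0); first exact: measurable_cst.
      by apply/funext => x; rewrite [LHS]mxE.
    by exists (enorm (0 : 'rV[R]_m)); apply: aeW => x _; exact: lexx.
  have L0 : L2 mu D (0 : T -> 'rV[R]_m).
    split; first by case: Linf0.
    rewrite integral0_eq// => x _; rewrite sqr_enorm /dotv big1// => i _.
    by rewrite [X in X * _]mxE mul0r.
  elim/big_rec : _ => // i h _ [Lih Lh]; have [Lie Le] := he i.
  by split; [exact: Linfty_linear|exact: L2_linear].
have {}fE : \sum_i c i *: e i = f %[ae mu in D].
  by apply: filterS fE => x fE Dx; rewrite fE.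
by split; [exact: ae_Linfty fE Linf|exact: ae_L2 fE L].
Qed.

Lemma fin_dim_Linfty_subspaceB (W : set (T -> 'rV[R]_m)) f g :
  fin_dim_Linfty_subspace mu D W -> W f -> W g -> W (f - g).
Proof.
move=> [N [e [_ WE]]] /WE[b fE] /WE[c gE]; apply/WE; exists (b \- c).
apply: filterS2 fE gE => x fE gE Dx.
rewrite (_ : (f - g) x = f x - g x)// fE// gE// !fct_sumE -sumrB.
by apply: eq_bigr => i _; rewrite -scalerBl.
Qed.

End L2_theory.

(** * Convexity and error estimate in the space [V] *)

Section variational.
Context {R : realType} {V : normedModType R}.
Variables (L : V -> {scalar V}) (F : {scalar V}) (Ccoerc : R).
Hypothesis L_linearl : forall a u u' v, L (a *: u + u') v = a * L u v + L u' v.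
Hypothesis Ccoerc_gt0 : 0 < Ccoerc.
Hypothesis L_coercive : forall u, Ccoerc * `|u| ^+ 2 <= L u u.

Lemma L_additivel u u' v : L (u + u') v = L u v + L u' v.
Proof. by have := L_linearl 1 u u' v; rewrite scale1r mul1r. Qed.

Lemma L_subl u u' v : L (u - u') v = L u v - L u' v.
Proof. by apply/eqP; rewrite eq_sym subr_eq -L_additivel subrK. Qed.

(* Jensen's inequality for the convex function [u |-> L u (u - w) - F (u - w)]. *)
Lemma weighted_mean_le (alpha : nat -> R) (u : nat -> V) (w : V) l
    (S := \sum_(1 <= k < l.+1) alpha k) (ul := weighted_mean alpha u l) :
  (1 <= l)%N -> (forall k, (1 <= k)%N -> 0 < alpha k) ->
  S * (L ul (ul - w) - F (ul - w)) <=
  \sum_(1 <= k < l.+1) alpha k * (L (u k) (u k - w) - F (u k - w)).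
Proof.
move=> l1 alpha0.
have S0 : 0 < S.
  rewrite /S big_ltn// ltr_pwDl ?alpha0//.
  rewrite big_nat_cond sumr_ge0// => k /andP[/andP[k2 _] _].
  by rewrite ltW ?alpha0// ltnW.
(* [ell] is the derivative of the functional at [ul]. The weighted sum of [ell (u k - ul)] vanishes
   since [ul] is the barycentre, and the quadratic remainder is nonnegative by coercivity. *)
pose ell x := L x ul + L ul x - L x w - F x.
have ellP a x y : ell (a *: x + y) = a * ell x + ell y.
  by rewrite /ell !L_linearl (linearP (L ul)) (linearP F)/=; ring.
have ell0 : ell 0 = 0.
  by have := ellP (-1) 0 0; rewrite scaler0 addr0 mulN1r addNr.
have ell_sum : \sum_(1 <= k < l.+1) alpha k * ell (u k - ul) = 0.
  transitivity (ell (\sum_(1 <= k < l.+1) alpha k *: (u k - ul))).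
    by elim/big_rec2 : _ => [//|k x y _ ->]; rewrite ellP.
  under eq_bigr do rewrite scalerBr.
  rewrite sumrB -scaler_suml -/S /ul /weighted_mean scalerA divff ?gt_eqF//.
  by rewrite scale1r subrr.
rewrite -[leLHS]addr0 -{1}ell_sum /S mulr_suml -big_split/=.
rewrite big_nat_cond [leRHS]big_nat_cond; apply: ler_sum => k /andP[/andP[k1 _] _].
rewrite -mulrDr; apply: ler_wpM2l; first by rewrite ltW ?alpha0.
have : 0 <= L (u k - ul) (u k - ul).
  by rewrite (le_trans _ (L_coercive _))// mulr_ge0 ?sqr_ge0 ?ltW.
rewrite /ell !L_subl !(linearB (L (u k))) !(linearB (L ul)) !(linearB F)/=.
by lra.
Qed.

(** Split [L (ul - us) (ul - us)] at [w]. With [lambda = L us - F], the part along [ul - w] is at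
    most [E + lambda (w - us) + lambda (us - ul)], and [hv] gives
    [lambda (us - ul) <= lambda (v - ul)]. The part along [w - us] is bounded by [M * a * b]. *)
Lemma galerkin_error_le (M E : R) (us ul w v : V) :
  (forall x y, L x y <= M * `|x| * `|y|) ->
  0 <= L us (v - us) - F (v - us) ->
  L ul (ul - w) - F (ul - w) <= E ->
  Ccoerc / 4 * `|ul - us| ^+ 2 <=
  E + ((M ^+ 2 + Ccoerc ^+ 2) / (2 * Ccoerc) * `|w - us| ^+ 2
       + `|L us (w - us) - F (w - us)| + `|L us (v - ul) - F (v - ul)|).
Proof.
move=> hM hv hE.
have hc := L_coercive (ul - us).
have hb := hM (ul - us) (w - us).
have h1 := ler_norm (L us (w - us) - F (w - us)).
have h2 := ler_norm (L us (v - ul) - F (v - ul)).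
set a := `|ul - us| in hc hb *; set b := `|w - us| in hb *.
set n1 := `|L us _ - _| in h1 *; set n2 := `|L us _ - _| in h2 *.
(* The weight is chosen so that half of the coercivity term absorbs [a ^+ 2]. *)
have young : M * a * b <= Ccoerc / 2 * a ^+ 2 + M ^+ 2 / (2 * Ccoerc) * b ^+ 2.
  rewrite -subr_ge0 (_ : _ - _ = (Ccoerc * a - M * b) ^+ 2 / (2 * Ccoerc)).
    by rewrite divr_ge0 ?sqr_ge0// mulr_ge0// ltW.
  by field; rewrite gt_eqF.
have -> : (M ^+ 2 + Ccoerc ^+ 2) / (2 * Ccoerc) * b ^+ 2 =
    M ^+ 2 / (2 * Ccoerc) * b ^+ 2 + Ccoerc / 2 * b ^+ 2.
  by field; rewrite gt_eqF.
(* [b0] and [a0] are the slack between the bound obtained and the stated constants. *)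
have b0 : 0 <= Ccoerc / 2 * b ^+ 2 by rewrite mulr_ge0 ?sqr_ge0// divr_ge0// ltW.
have a0 : 0 <= Ccoerc / 4 * a ^+ 2 by rewrite mulr_ge0 ?sqr_ge0// divr_ge0// ltW.
move: hc hb hv hE h1 h2; rewrite !L_subl.
rewrite !(linearB (L ul)) !(linearB (L us)) !(linearB F)/=.
by lra.
Qed.

End variational.

(** * Integration of the telescoped inequality *)

Section Rintegral_sum.
Context d {T : measurableType d} {R : realType}.
Variables (mu : {measure set T -> \bar R}) (D : set T).

Lemma integrable_sum_ord n (g : nat -> T -> R) : measurable D ->
  (forall k, mu.-integrable D (EFin \o g k)) ->
  mu.-integrable D (EFin \o (fun x => \sum_(k < n) g k x)) /\
  \int[mu]_(x in D) (\sum_(k < n) g k x) =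
  \sum_(k < n) \int[mu]_(x in D) g k x.
Proof.
move=> mD ig; elim: n => [|n [iS SE]].
  rewrite big_ord0; split.
    apply: (eq_integrable mD (cst 0%E)); last exact: integrable0.
    by move=> x _ /=; rewrite big_ord0.
  rewrite (@eq_Rintegral _ _ _ mu D (cst 0)) ?Rintegral_cst ?mul0r// => x _.
  by rewrite big_ord0.
have E : (fun x => \sum_(k < n.+1) g k x) = (fun x => \sum_(k < n) g k x + g n x).
  by apply/funext => x; rewrite big_ord_recr.
rewrite E; split; first exact: (integrableD mD iS (ig n)).
by rewrite RintegralD// SE big_ord_recr.
Qed.

End Rintegral_sum.

Section bregman_integral.
Context d {T : measurableType d} {R : realType} {m : nat}.
Variables (mu : {measure set T -> \bar R}) (D : set T).
Variables (C : T -> set 'rV[R]_m) (Rf : T -> 'rV[R]_m -> \bar R).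

Lemma integral_bregman_telescope (v : T -> 'rV[R]_m)
    (psi : nat -> T -> 'rV[R]_m) l (o := fun k => nabla_conj Rf (psi k)) :
  measurable D ->
  (\forall x \ae mu, D x ->
     [/\ legendre (Rf x), edom (Rf x) = C x & supercoercive (Rf x)]) ->
  (forall k, \forall x \ae mu, D x -> ediff (econj (Rf x)) (psi k x)) ->
  (forall k, \forall x \ae mu, D x -> (C x)° (o k x)) ->
  (\forall x \ae mu, D x -> C x (v x)) ->
  mu.-integrable D (EFin \o (fun x =>
    \sum_(k < l) dotv (o k.+1 x - v x) (psi k x - psi k.+1 x))) ->
  (\int[mu]_(x in D)
     (\sum_(k < l) dotv (o k.+1 x - v x) (psi k x - psi k.+1 x))%:E <=
   \int[mu]_(x in D) bregman Rf v (o 0%N) x)%E.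
Proof.
(* The null sets for all [k] are merged into one. *)
move=> mD legRf /ae_foralln dconj /ae_foralln ointC vC ig.
apply: (integrable_le_integral mD ig).
apply: filterS (filterI (filterI dconj ointC) (filterI legRf vC)).
move=> x [[dx ix] [Rx Kx]] Dx.
have [legx domx supx] := Rx Dx.
have subx k : subgradient (Rf x) (o k x) (psi k x).
  exact: egrad_econj_subgradient legx supx (dx k Dx).
have Ry := legendre_nNy legx.
have int0 : (edom (Rf x))° (o 0%N x) by rewrite domx; exact: ix.
have domv : edom (Rf x) (v x) by rewrite domx; exact: Kx.
rewrite /bregman (egrad_subgradient Ry int0 (legendre_diff legx int0) (subx 0%N)).
have tele j := bregman_telescope (o := o^~ x) (psi := psi^~ x) (l := j) Ry domv
  (fun k _ => subx k).
(* The empty sum [j = 0] gives nonnegativity of the Bregman integrand, and [j = l] the lower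
   bound. *)
by split; [have := tele 0%N; rewrite big_ord0|exact: tele].
Qed.

End bregman_integral.

(** * Assembly of the error estimate *)

Lemma fin_dim_subspaceB (R : realType) (V : normedModType R) (W : set V) x y :
  fin_dim_subspace W -> W x -> W y -> W (x - y).
Proof.
move=> [N [e WE]] /WE[b ->] /WE[c ->]; apply/WE; exists (b \- c).
by rewrite -sumrB; apply: eq_bigr => i _; rewrite -scalerBl.
Qed.

Unset Implicit Arguments.
Set Strict Implicit.

Theorem theorem3p3
  (R : realType) (n m : nat) (hn : (1 <= n <= 3)%N) (hm : (0 < m)%N)
  (* the domain and the observation set *)
  (Omega : set 'rV[R]_n) (hOmega : bounded_lipschitz_domain Omega)
  (d : R) (hd : 0 <= d <= n%:R)
  (Od : set (hspace n d)) (hOd : measurable Od)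
  (hOdOmega : (Od : set 'rV[R]_n) `<=` closure Omega)
  (hOddim : hausdorff_dim (Od : set 'rV[R]_n) = d%:E)
  (* the Hilbert space V, the operator and the load *)
  (V : completeNormedModType R)
  (ip : V -> V -> R) (hip : is_inner_product ip)
  (L : V -> {scalar V})
  (hLc : forall u, continuous (L u : V -> R^o))
  (hLlin : forall a u u' v, L (a *: u + u') v = a * L u v + L u' v)
  (F : {scalar V}) (hFc : continuous (F : V -> R^o))
  (c1 Cbnd Ccoerc : R) (hc1 : 0 <= c1) (hCbnd : 0 < Cbnd) (hCcoerc : 0 < Ccoerc)
  (hAn : forall u v, (L u v - L v u) / 2 <= c1 * `|u| * `|v|)
  (hA0 : forall u v, (L u v + L v u) / 2 <= Cbnd * `|u| * `|v|)
  (hAcoerc : forall u, Ccoerc * `|u| ^+ 2 <= L u u)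
  (* the Banach space Q and the observation map B *)
  (Q : completeNormedModType R)
  (iota : Q -> hspace n d -> 'rV[R]_m)
  (hiota : L2_dense_embedding (hmeasure n d) Od iota)
  (B : {linear V -> Q}) (hBc : continuous B) (hBim : range B = setT)
  (* the pointwise constraints and the Legendre function *)
  (C : hspace n d -> set 'rV[R]_m)
  (hC : \forall x \ae hmeasure n d, Od x ->
          [/\ closed (C x), convex_set (C x) & (C x)° !=set0])
  (Rf : hspace n d -> 'rV[R]_m -> \bar R)
  (hRcar : caratheodory_fun (hmeasure n d) Od Rf)
  (hRleg : \forall x \ae hmeasure n d, Od x ->
          [/\ legendre (Rf x), edom (Rf x) = C x & supercoercive (Rf x)])
  (hRconj : nabla_conj_regular (hmeasure n d) Od C Rf)
  (* the variational inequality and the dual variable *)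
  (us : V) (husK : feasible_set (hmeasure n d) Od C iota B us)
  (hus : forall v, feasible_set (hmeasure n d) Od C iota B v ->
          F (v - us) <= L us (v - us))
  (lambda : {scalar Q}) (hlambdac : continuous (lambda : Q -> R^o))
  (hlambda : forall v, lambda (B v) = L us v - F v)
  (* the discrete spaces and the Fortin operator *)
  (Vh : set V) (hVh : fin_dim_subspace Vh)
  (Wh : set (hspace n d -> 'rV[R]_m))
  (hWh : fin_dim_Linfty_subspace (hmeasure n d) Od Wh)
  (muh : \bar R) (mu0 : R)
  (hmuh : infsup_const (hmeasure n d) Od iota B Vh Wh = muh)
  (hmu0h : (mu0%:E < muh)%E) (hmu0 : 0 < mu0)
  (Pih : {linear V -> V}) (hPihc : continuous Pih)
  (hPihV : forall v, Vh (Pih v))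
  (hFortin : forall v w, Wh w ->
          l2ip (hmeasure n d) Od (iota (B (v - Pih v))) w = 0)
  (* the discrete iteration *)
  (alpha : nat -> R) (halpha : forall k, (1 <= k)%N -> 0 < alpha k)
  (u : nat -> V) (psi : nat -> hspace n d -> 'rV[R]_m)
  (hpsi0 : Wh (psi 0%N))
  (huV : forall k, (1 <= k)%N -> Vh (u k))
  (hpsiW : forall k, (1 <= k)%N -> Wh (psi k))
  (hstep1 : forall k, (1 <= k)%N -> forall v, Vh v ->
          alpha k * L (u k) v
          + l2ip (hmeasure n d) Od (iota (B v)) (psi k - psi k.-1)
          = alpha k * F v)
  (hstep2 : forall k, (1 <= k)%N -> forall w, Wh w ->
          l2ip (hmeasure n d) Od (iota (B (u k))) w
          - l2ip (hmeasure n d) Od (nabla_conj Rf (psi k)) w = 0)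
  (l : nat) (hl : (1 <= l)%N) :
  ((Ccoerc / 4 * `|weighted_mean alpha u l - us| ^+ 2)%:E
   <= (\int[hmeasure n d]_(x in Od)
         bregman Rf (iota (B us)) (nabla_conj Rf (psi 0%N)) x)
        * ((\sum_(1 <= k < l.+1) alpha k)^-1)%:E
      + (((Cbnd + c1) ^+ 2 + Ccoerc ^+ 2) / (2 * Ccoerc)
           * `|Pih us - us| ^+ 2
         + `|lambda (B (Pih us - us))|
         + inf [set `|lambda (B (v - weighted_mean alpha u l))|
               | v in feasible_set (hmeasure n d) Od C iota B])%:E)%E.

Proof.
pose mu := hmeasure n d.
have cmu : measure_is_complete mu by exact: measure_is_complete_caratheodory.
pose o k := nabla_conj Rf (psi k); pose os := iota (B us).
pose S := \sum_(1 <= k < l.+1) alpha k; pose ul := weighted_mean alpha u l.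
have psiW k : Wh (psi k) by case: k => [//|k]; exact: hpsiW.
have psireg k := fin_dim_Linfty_subspace_regular hOd cmu hWh (psiW k).
have psiL k : L2 mu Od (psi k) by case: (psireg k).
have [iotaL iota_lin _ _ _] := hiota.
have [conj_diff conj_feas conj_int _] := hRconj.
have oL k : L2 mu Od (o k) by have [Linf _] := psireg k; case: (conj_feas _ Linf).
have iotaB x y w : L2 mu Od w ->
    l2ip mu Od (iota (B (x - y))) w =
    l2ip mu Od (iota (B x)) w - l2ip mu Od (iota (B y)) w.
  move=> Lw; have BE :
      iota (B (x - y)) = -1 *: iota (B y) + iota (B x) %[ae mu in Od].
    by rewrite linearB/= addrC -scaleN1r; exact: iota_lin.
  rewrite (l2ip_linearl hOd (iotaL (B y)) (iotaL (B x)) _ Lw BE).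
    by rewrite mulN1r addrC.
  exact: iotaL.
(* [g k] belongs to step [k.+1] of the iteration. *)
pose g k x := dotv (o k.+1 x - os x) (psi k x - psi k.+1 x).
have ig k : mu.-integrable Od (EFin \o g k).
  have Lo := L2_linear hOd (-1) (iotaL (B us)) (oL k.+1).
  have Lpsi := L2_linear hOd (-1) (psiL k.+1) (psiL k).
  have := integrable_dotv hOd Lo Lpsi; apply: eq_integrable => // x _ /=.
  by rewrite /g !scaleN1r addrC (addrC (psi k x)).
have step k : alpha k.+1 * (L (u k.+1) (u k.+1 - Pih us) - F (u k.+1 - Pih us)) =
    \int[mu]_(x in Od) g k x.
  have kw : Wh (psi k.+1 - psi k) by exact: fin_dim_Linfty_subspaceB hWh _ _.
  have [_ wL] := fin_dim_Linfty_subspace_regular hOd cmu hWh kw.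
  have Vv : Vh (u k.+1 - Pih us).
    by apply: fin_dim_subspaceB => //; exact: huV.
  (* Against the increment of [psi], the Fortin property [e1] replaces [Pih us] by [us] and the
     second equation [e2] replaces [iota (B (u k.+1))] by [o k.+1]; both enter the tested first
     equation [e3]. *)
  have := hstep1 k.+1 isT _ Vv; have := hstep2 k.+1 isT _ kw.
  have := hFortin us _ kw; rewrite -/mu !iotaB// -/os -/(o k.+1) => e1 e2 /= e3.
  have -> : \int[mu]_(x in Od) g k x =
      l2ip mu Od os (psi k.+1 - psi k) - l2ip mu Od (o k.+1) (psi k.+1 - psi k).
    rewrite -(RintegralB hOd (integrable_dotv hOd (iotaL (B us)) wL)
                             (integrable_dotv hOd (oL k.+1) wL)).
    apply: eq_Rintegral => x _.
    rewrite /g -[(psi k.+1 - psi k) x]/(psi k.+1 x - psi k x).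
    by rewrite dotvBl !dotvBr; ring.
  by lra.
have bregman_lb : (\int[mu]_(x in Od) (\sum_(k < l) g k x)%:E <=
    \int[mu]_(x in Od) bregman Rf os (o 0%N) x)%E.
  have [igs _] := integrable_sum_ord l hOd ig.
  apply: (integral_bregman_telescope hOd hRleg _ _ husK igs) => k.
    by apply: conj_diff; case: (psireg k).
  by apply: conj_int; case: (psireg k).
have lamE x : lambda (B x) = L us x - F x by exact: hlambda.
(* [L] is the sum of its symmetric and skew parts. *)
have LM x y : L x y <= (Cbnd + c1) * `|x| * `|y|.
  by have := hAn x y; have := hA0 x y; lra.
have S0 : 0 < S.
  rewrite /S big_ltn// ltr_pwDl ?halpha//.
  rewrite big_nat_cond sumr_ge0// => k /andP[/andP[k2 _] _].
  by rewrite ltW ?halpha// ltnW.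
have jensen := weighted_mean_le F hLlin hCcoerc hAcoerc u (Pih us) hl halpha.
have [igs sumE] := integrable_sum_ord l hOd ig.
have energy : S * (L ul (ul - Pih us) - F (ul - Pih us)) <=
    \int[mu]_(x in Od) (\sum_(k < l) g k x).
  apply: le_trans jensen _; rewrite sumE big_add1/= big_mkord.
  by apply: ler_sum => k _; rewrite -step.
have {}energy : ((S * (L ul (ul - Pih us) - F (ul - Pih us)))%:E <=
    \int[mu]_(x in Od) bregman Rf os (o 0%N) x)%E.
  apply: le_trans bregman_lb; rewrite -[leRHS]fineK; first by rewrite lee_fin.
  exact: integrable_fin_num.
rewrite -/mu -/ul -/S; move: energy; rewrite /os /o.
(* If the Bregman integral is [+oo] the estimate is trivial; [energy] excludes [-oo]. *)
case: (integral _ _ _) => [I| |]//; last first.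
  by rewrite gt0_mulye ?lte_fin ?invr_gt0// => _; rewrite addye ?leey.
rewrite lee_fin mulrC -ler_pdivlMr// => energy; rewrite -EFinM -EFinD lee_fin.
(* The remaining terms do not depend on [v], so it suffices to bound each element of the set, which
   is nonempty because [us] is feasible. *)
rewrite -lerBlDl -lerBlDl; apply: lb_le_inf.
  by exists `|lambda (B (us - ul))|; exists us.
move=> _ [v Kv <-].
have := galerkin_error_le hLlin hCcoerc hAcoerc (w := Pih us) (v := v) LM _ energy.
rewrite !lamE => /(_ us); rewrite subr_ge0 => /(_ (hus _ Kv)).
by lra.
Qed.
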